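(* Let $\tau\in S(d)$. For all $\alpha\in\mathbb{A}$, and for $\lambda=1/(k+\Phi)$ and $\eta=1-k\lambda$ with $k\geq 1$ an integer, there is an open set $U\subseteq\mathbb{C}$ containing the origin such that $$R(\Phi^2 z)=\Phi^2R(z)\qquad\text{for all } z\in U\cap P_c .$$
   Context: $\Phi=(\sqrt5-1)/2$. Translated cone exchange transformations (TCEs): let $d\geq 2$ be an integer, $\mathbb{A}=\{\alpha\in\mathbb{R}_+^d: 0<\sum_{j=1}^d\alpha_j<\pi\}$ (positive entries), $|\alpha|=\sum_j\alpha_j$, $\beta=\frac{\pi}{2}-\frac{|\alpha|}{2}$, and $\mathbb{H}=\{z\in\mathbb{C}:\mathrm{Im}(z)>0\}$. Put $W_0=[0,\beta)$, $W_1=[\beta,\beta+\alpha_1]$, $W_j=(\beta+\sum_{i=1}^{j-1}\alpha_i,\ \beta+\sum_{i=1}^{j}\alpha_i]$ for $2\leq j\leq d$, $W_{d+1}=(\pi-\beta,\pi]$, and $P_j=\{z\in\mathbb{H}:\arg(z)\in W_j\}$ for $0\le j\le d+1$. The middle cone is $P_c=P_1\cup\dots\cup P_d$. For a permutation $\tau\in S(d)$ of $\{1,\dots,d\}$ let $\theta_j=\theta_j(\alpha,\tau)=\sum_{\tau(i)<\tau(j)}\alpha_i-\sum_{i<j}\alpha_i$. Define $E:\mathbb{H}\to\mathbb{H}$ by $E(z)=z$ on $P_0\cup P_{d+1}$ and $E(z)=ze^{i\theta_j}$ on $P_j$, $1\le j\le d$. For $\lambda\in\mathbb{R}^+\setminus\mathbb{Q}$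 and $0<\eta<\lambda$ define $G:\mathbb{H}\to\mathbb{H}$ by $G(z)=z-1$ on $P_0$, $G(z)=z-\eta$ on $P_c$, $G(z)=z+\lambda$ on $P_{d+1}$. The TCE is $F=G\circ E$. The first return map $R:P_c\to P_c$ is $R(z)=F^{N(z)}(z)$, where $N(z)=\inf\{n\geq 1:F^n(z)\in P_c\}$. *)

(* Defs.v *)
From HB Require Import structures.
From mathcomp Require Import all_boot all_order all_algebra all_fingroup.
From mathcomp Require Import all_classical all_reals all_analysis.
From mathcomp Require Import complex.
From mathcomp Require Import ring lra.

Set Implicit Arguments.
Unset Strict Implicit.
Unset Printing Implicit Defensive.

Import Order.TTheory GRing.Theory Num.Theory.
Import numFieldNormedType.Exports.

Local Open Scope classical_set_scope.
Local Open Scope ring_scope.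
Local Open Scope complex_scope.

Definition Phi (R : realType) : R := (Num.sqrt 5 - 1) / 2.

(* Principal argument, with values in ]-pi, pi]; see [arg_polar]. *)
Definition arg (R : realType) (z : R[i]) : R :=
  let t := acos (complex.Re z / Num.sqrt (complex.Re z ^+ 2 + complex.Im z ^+ 2)) in
  if 0 <= complex.Im z then t else - t.

(* cis t is e^(it) *)
Definition cis (R : realType) (t : R) : R[i] := cos t +i* sin t.

Definition upper_half_plane (R : realType) : set R[i] := [set z | 0 < complex.Im z].

Definition admissible (R : realType) (d : nat) : set ('I_d -> R) :=
  [set alpha | (forall j, 0 < alpha j) /\ 0 < \sum_j alpha j < pi].

Definition beta (R : realType) (d : nat) (alpha : 'I_d -> R) : R :=
  pi / 2 - (\sum_j alpha j) / 2.

(* Ordinals are 0-based: for the 1-based alpha_1, ..., alpha_d, this is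
   cut alpha j = beta + alpha_1 + ... + alpha_j. *)
Definition cut (R : realType) (d : nat) (alpha : 'I_d -> R) (j : nat) : R :=
  beta alpha + \sum_(i < d | (i < j)%N) alpha i.

(* Meaningful for j <= d + 1 *)
Definition W (R : realType) (d : nat) (alpha : 'I_d -> R) (j : nat) : set R :=
  match j with
  | 0 => `[0, beta alpha[%classic
  | 1 => `[cut alpha 0, cut alpha 1]%classic
  | j'.+1 => if (j' < d)%N then `]cut alpha j', cut alpha j'.+1]%classic
             else `]pi - beta alpha, pi]%classic
  end.

Definition cone (R : realType) (d : nat) (alpha : 'I_d -> R) (j : nat) :
    set R[i] :=
  [set z | upper_half_plane z /\ W alpha j (arg z)].

Definition middle_cone (R : realType) (d : nat) (alpha : 'I_d -> R) :
    set R[i] :=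
  [set z | exists2 j : nat, (1 <= j <= d)%N & cone alpha j z].

Definition theta (R : realType) (d : nat) (alpha : 'I_d -> R) (tau : 'S_d)
    (j : 'I_d) : R :=
  \sum_(i < d | (tau i < tau j)%N) alpha i - \sum_(i < d | (i < j)%N) alpha i.

(* The maps E, G, F = G o E and the first return map of F are [exchange],
   [translation], [tce] and [first_return]. They are only meaningful on the
   upper half plane (on the middle cone for [first_return]); outside it, E and
   G are the identity. *)
Definition exchange (R : realType) (d : nat) (alpha : 'I_d -> R) (tau : 'S_d)
    (z : R[i]) : R[i] :=
  if [pick j : 'I_d | z \in cone alpha j.+1] is Some j
  then z * cis (theta alpha tau j) else z.

Definition translation (R : realType) (d : nat) (alpha : 'I_d -> R)
    (lambda eta : R) (z : R[i]) : R[i] :=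
  if z \in cone alpha 0 then z - 1
  else if z \in middle_cone alpha then z - eta%:C
  else if z \in cone alpha d.+1 then z + lambda%:C
  else z.

Definition tce (R : realType) (d : nat) (alpha : 'I_d -> R) (tau : 'S_d)
    (lambda eta : R) (z : R[i]) : R[i] :=
  translation alpha lambda eta (exchange alpha tau z).

(* The least n >= 1 such that F^n(z) is in the middle cone. The default value
   0 of [xget] is never taken on the middle cone when lambda is positive and
   irrational: see [return_timeP] and [golden_parameters]. *)
Definition return_time (R : realType) (d : nat) (alpha : 'I_d -> R)
    (tau : 'S_d) (lambda eta : R) (z : R[i]) : nat :=
  let returns (n : nat) :=
    (1 <= n)%N /\ middle_cone alpha (iter n (tce alpha tau lambda eta) z) in
  xget 0%N [set n | returns n /\ forall m : nat, returns m -> (n <= m)%N].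

Definition first_return (R : realType) (d : nat) (alpha : 'I_d -> R)
    (tau : 'S_d) (lambda eta : R) (z : R[i]) : R[i] :=
  iter (return_time alpha tau lambda eta z) (tce alpha tau lambda eta) z.

Lemma arg_polar (R : realType) (z : R[i]) : z != 0 ->
  - pi < arg z <= pi /\
  z = (Num.sqrt (complex.Re z ^+ 2 + complex.Im z ^+ 2))%:C * cis (arg z).
Proof.
case: z => x y; rewrite eq_complex /= negb_and => xy0.
rewrite /arg /=; set r := Num.sqrt _.
have r2 : r ^+ 2 = x ^+ 2 + y ^+ 2 by rewrite sqr_sqrtr// addr_ge0 ?sqr_ge0.
have r0 : 0 < r.
  rewrite sqrtr_gt0; have := sqr_ge0 x; have := sqr_ge0 y.
  by case/orP: xy0; rewrite -sqrf_eq0 lt_neqAle => n0 *; nra.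
set q := x / r.
have qr : x = r * q by rewrite /q mulrC divfK ?gt_eqF.
have q1 : q ^+ 2 <= 1.
  by rewrite -(ler_pM2l (exprn_gt0 2 r0)) -exprMn -qr r2 mulr1 lerDl sqr_ge0.
have q11 : -1 <= q <= 1 by apply/andP; split; nra.
have sq : Num.sqrt (1 - q ^+ 2) = `|y| / r.
  have -> : 1 - q ^+ 2 = (`|y| / r) ^+ 2.
    rewrite /q !exprMn !exprVn real_normK ?num_real//.
    have -> : y ^+ 2 = r ^+ 2 - x ^+ 2 by rewrite r2; ring.
    by field; rewrite gt_eqF.
  by rewrite sqrtr_sqr ger0_norm ?divr_ge0 ?normr_ge0 ?(ltW r0).
have a0 := acos_ge0 q11; have api := acos_lepi q11.
have pi0 := pi_gt0 R.
case: (lerP 0 y) => y0; split.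
- by rewrite api andbT; lra.
- apply/eqP; rewrite eq_complex /= sin_acos// sq acosK ?in_itv//= !mul0r.
  rewrite -qr addr0 subr0 eqxx /= ger0_norm//.
  by apply/eqP; field; rewrite gt_eqF.
- apply/andP; split; last by lra.
  rewrite ltrN2 acos_ltpi//; case/andP: q11 => + ->; rewrite andbT.
  rewrite le_eqVlt => /orP[/eqP q_1|//].
  by exfalso; nra.
- apply/eqP; rewrite eq_complex /= sinN cosN sin_acos// sq acosK ?in_itv//=.
  rewrite !mul0r -qr addr0 subr0 eqxx /= ltr0_norm//.
  by apply/eqP; field; rewrite gt_eqF.
Qed.

Lemma arg_upper (R : realType) (z : R[i]) : upper_half_plane z ->
  0 < arg z < pi.
Proof.
rewrite /upper_half_plane /= => z0.
have zn0 : z != 0 by apply: contraTneq z0 => ->; rewrite ltxx.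
have [/andP[_ api] zE] := arg_polar zn0.
have a0 : 0 <= arg z.
  rewrite /arg (ltW z0) acos_ge0//.
  set q := _ / _; suff : q ^+ 2 <= 1 by move=> ?; apply/andP; split; nra.
  rewrite /q exprMn exprVn sqr_sqrtr ?addr_ge0 ?sqr_ge0//.
  by rewrite ler_pdivrMr ?mul1r ?lerDl ?sqr_ge0// ltr_wpDl ?sqr_ge0 ?exprn_gt0.
have sn0 : sin (arg z) != 0.
  apply: contraTneq z0 => s0; rewrite zE /= s0.
  by rewrite mulr0 mul0r addr0 ltxx.
rewrite !lt_neqAle a0 api !andbT; apply/andP; split.
  by apply: contra_neq sn0 => <-; rewrite sin0.
by apply: contra_neq sn0 => ->; rewrite sinpi.
Qed.

Lemma beta_bounds (R : realType) (d : nat) (alpha : 'I_d -> R) :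
  admissible alpha -> 0 < beta alpha < pi / 2.
Proof. by move=> [_ /andP[]]; rewrite /beta => *; apply/andP; split; lra. Qed.

Lemma cut_last (R : realType) (d : nat) (alpha : 'I_d -> R) :
  cut alpha d = pi - beta alpha.
Proof.
rewrite /cut (eq_bigl xpredT) => [|i]; last by rewrite ltn_ord.
by rewrite /beta; lra.
Qed.

Lemma cut0 (R : realType) (d : nat) (alpha : 'I_d -> R) :
  cut alpha 0 = beta alpha.
Proof. by rewrite /cut big_pred0 ?addr0. Qed.

Lemma W_bounds (R : realType) (d : nat) (alpha : 'I_d -> R) (j : 'I_d) t :
  W alpha j.+1 t -> cut alpha j <= t <= cut alpha j.+1.
Proof.
by case: j => [[|j] jd]; rewrite /= ?jd /= in_itv//= => /andP[/ltW -> ->].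
Qed.

Lemma middle_coneE (R : realType) (d : nat) (alpha : 'I_d -> R) (z : R[i]) :
  (0 < d)%N -> upper_half_plane z -> beta alpha <= arg z <= pi - beta alpha ->
  middle_cone alpha z.
Proof.
move=> d0 Hz /andP[h1]; rewrite -cut_last => h2.
have ex : exists j, (0 < j)%N && (arg z <= cut alpha j).
  by exists d; rewrite d0.
have [j /andP[j0 jz] jmin] := ex_minnP ex.
have jd : (j <= d)%N by apply: jmin; rewrite d0.
exists j; first by rewrite j0.
split=> //; case: j j0 jz jmin jd => [//|[|j]] _ jz jmin jd /=.
  by rewrite in_itv/= cut0 h1.
rewrite jd /= in_itv /= jz andbT ltNge.
by apply/negP => H; have := jmin j.+1; rewrite H ltnn => /(_ isT).
Qed.

Lemma exchange_upper (R : realType) (d : nat) (alpha : 'I_d -> R) (tau : 'S_d)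
    (z : R[i]) : admissible alpha -> upper_half_plane z ->
  upper_half_plane (exchange alpha tau z).
Proof.
move=> Aal z0; rewrite /exchange; case: pickP => [j|//].
rewrite inE => -[_ /W_bounds].
have zn0 : z != 0.
  by move: z0; rewrite /upper_half_plane/=; apply: contraTneq => ->; rewrite ltxx.
have [_ zE] := arg_polar zn0; set t := arg z in zE *.
set r := Num.sqrt _ in zE.
have r0 : 0 < r.
  rewrite sqrtr_gt0; move: z0; rewrite /upper_half_plane/= => z0.
  by rewrite ltr_wpDl ?sqr_ge0 ?exprn_gt0.
move=> /andP[t1 t2].
set S1 := \sum_(i < d | (i < j)%N) alpha i.
have t1' : beta alpha + S1 <= t by [].
have t2' : t <= beta alpha + S1 + alpha j.
  apply: le_trans t2 _; rewrite /cut -(addrA (beta alpha)) lerD2l.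
  rewrite (bigD1 j) //= addrC lerD2r.
  rewrite (eq_bigl (fun i : 'I_d => (i < j)%N)) // => i.
  by rewrite ltnS ltn_neqAle andbC -val_eqE.
have [apos /andP[_ spi]] := Aal.
have /andP[b0 b1] := beta_bounds Aal.
set S2 := \sum_(i < d | (tau i < tau j)%N) alpha i.
have S20 : 0 <= S2 by apply: sumr_ge0 => i _; exact: ltW.
have S2a : S2 + alpha j <= \sum_i alpha i.
  rewrite (bigD1 j (P := xpredT)) //= (addrC S2) lerD2l.
  rewrite [leRHS](bigID (fun i : 'I_d => (tau i < tau j)%N)) /=.
  rewrite [X in _ <= X + _](eq_bigl (fun i : 'I_d => (tau i < tau j)%N)) => [|i].
    by rewrite lerDl sumr_ge0// => i _; exact: ltW.
  by apply: andb_idl; apply: contraTneq => ->; rewrite ltnn.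
have thE : theta alpha tau j = S2 - S1 by [].
rewrite /upper_half_plane /= {1}zE /= !mul0r subr0 addr0.
rewrite -!mulrA -mulrDr mulr_gt0// addrC.
have -> : sin t * cos (theta alpha tau j) + cos t * sin (theta alpha tau j)
        = sin (t + theta alpha tau j) by rewrite sinD.
apply: sin_gt0_pi; rewrite thE; apply/andP; split; first by lra.
by have := pi_gt0 R; rewrite /beta in t2' b0 b1 t1' *; lra.
Qed.

Lemma outside_middle (R : realType) (d : nat) (alpha : 'I_d -> R) (z : R[i]) :
  (0 < d)%N -> admissible alpha -> upper_half_plane z -> ~ middle_cone alpha z ->
  let c := complex.Im z * cos (beta alpha) in
  (cone alpha 0 z /\ c < complex.Re z) \/
  (~ cone alpha 0 z /\ cone alpha d.+1 z /\ complex.Re z < - c).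
Proof.
move=> d0 Aal z0 nz c.
have /andP[a0 api] := arg_upper z0.
have /andP[b0 b1] := beta_bounds Aal.
have y0 : 0 < complex.Im z := z0.
have zn0 : z != 0 by apply: contraTneq y0 => ->; rewrite ltxx.
have [_ zE] := arg_polar zn0.
set r := Num.sqrt _ in zE.
have xE : complex.Re z = r * cos (arg z) by rewrite {1}zE /= mul0r subr0.
have yE : complex.Im z = r * sin (arg z) by rewrite {1}zE /= mul0r addr0.
have r0 : 0 < r by rewrite sqrtr_gt0 ltr_wpDl ?sqr_ge0 ?exprn_gt0.
have cb : 0 < cos (beta alpha).
  by apply: cos_gt0_pihalf; apply/andP; split=> //; lra.
have yr : complex.Im z <= r by rewrite yE ler_piMr ?sin_le1// ltW.
have cr : c <= r * cos (beta alpha) by rewrite /c ler_pM2r.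
have pi0 := pi_gt0 R.
have [ab|ba] := ltP (arg z) (beta alpha); [left|right].
  split; first by split=> //=; rewrite in_itv/= (ltW a0).
  apply: le_lt_trans cr _; rewrite xE ltr_pM2l//.
  by rewrite ltr_cos// in_itv/=; apply/andP; split; lra.
have [ab|ab] := leP (arg z) (pi - beta alpha).
  by exfalso; apply: nz; apply: middle_coneE => //; rewrite ba.
split; first by move=> -[_ /=]; rewrite in_itv/= ltNge ba andbF.
split.
  by split=> //; case: d d0 alpha {Aal nz c cr cb b0 b1} ba ab => // d _ alpha ba ab;
    rewrite /= ltnn /= in_itv/= ab ltW.
rewrite ltrNr; apply: le_lt_trans cr _; rewrite xE -mulrN ltr_pM2l//.
have -> : - cos (arg z) = cos (pi - arg z) by rewrite addrC cosDpi cosN.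
rewrite ltr_cos ?in_itv/=; first by lra.
all: by apply/andP; split; lra.
Qed.

Lemma tce_outside (R : realType) (d : nat) (alpha : 'I_d -> R) (tau : 'S_d)
    (lambda eta : R) (z : R[i]) :
  (0 < d)%N -> admissible alpha -> upper_half_plane z -> ~ middle_cone alpha z ->
  let c := complex.Im z * cos (beta alpha) in
  (c < complex.Re z /\ tce alpha tau lambda eta z = z - 1) \/
  (complex.Re z < - c /\ tce alpha tau lambda eta z = z + lambda%:C).
Proof.
move=> d0 Aal z0 nz c.
have EE : exchange alpha tau z = z.
  rewrite /exchange; case: pickP => // j; rewrite inE => zj.
  by exfalso; apply: nz; exists j.+1 => //; rewrite ltnS leq0n ltn_ord.
rewrite /tce EE /translation.
have [[z1 cz]|[z1 [z2 cz]]] := outside_middle d0 Aal z0 nz; [left|right].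
  by rewrite mem_set.
by rewrite memNset// memNset// mem_set.
Qed.

Lemma translation_upper (R : realType) (d : nat) (alpha : 'I_d -> R)
    (lambda eta : R) (z : R[i]) :
  complex.Im (translation alpha lambda eta z) = complex.Im z.
Proof.
rewrite /translation; do ![case: ifP => _]; case: z => x y //=;
by rewrite ?oppr0 addr0.
Qed.

Lemma no_avoidance (R : realType) (u : nat -> R) (lambda c : R) :
  0 < lambda -> irrational lambda -> 0 < c ->
  (forall n, (c < u n /\ u n.+1 = u n - 1) \/
             (u n < - c /\ u n.+1 = u n + lambda)) -> False.
Proof.
move=> l0 lirr c0 uS.
pose B := `|u 0%N| + 1 + lambda.
have uB n : - B < u n < B.
  elim: n => [|n /andP[h1 h2]].
    by have := ler_norm (u 0%N); have := lerNnormlW (lexx `|u 0%N|);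
       rewrite /B => *; apply/andP; split; lra.
  have n0 := normr_ge0 (u 0%N).
  by case: (uS n) => -[h ->]; rewrite /B in h1 h2 *; apply/andP; split; lra.
have uab n p : exists a b : nat,
    (a + b = p)%N /\ u (n + p)%N = u n + a%:R * lambda - b%:R.
  elim: p => [|p [a [b [ab IH]]]].
    by exists 0%N, 0%N; rewrite !addn0 mul0r addr0 subr0.
  rewrite addnS; case: (uS (n + p)%N) => -[_ ->]; rewrite IH.
    by exists a, b.+1; rewrite addnS ab; split=> //; rewrite -natr1; ring.
  by exists a.+1, b; rewrite addSn ab; split=> //; rewrite -natr1; ring.
have udiff n p : (0 < p)%N -> u (n + p)%N != u n.
  move=> p0; have [a [b [abp ->]]] := uab n p.
  apply/eqP => /eqP; rewrite -addrA -subr_eq0 addrAC subrr add0r subr_eq0 => /eqP alb.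
  have a0 : (a != 0)%N.
    apply: contraTneq p0 => a0; move: alb abp; rewrite a0 mul0r => /esym/eqP.
    by rewrite pnatr_eq0 => /eqP -> <-.
  apply: lirr; apply/rationalP; exists (Posz b), a.
  by rewrite -[in RHS]pmulrn -alb mulrC mulKf ?pnatr_eq0.
have [i [p [p0 close]]] : exists i p, (0 < p)%N /\ `|u (i + p)%N - u i| < c.
  pose g n := Num.truncn ((u n + B) / c).
  pose M := (Num.truncn ((B + B) / c)).+1.
  have gM n : (g n < M)%N.
    rewrite ltnS; apply: le_truncn; rewrite ler_pM2r ?invr_gt0//.
    by have /andP[_ /ltW] := uB n; rewrite lerD2r.
  pose f (n : 'I_M.+1) : 'I_M := Ordinal (gM n).
  have /injectivePn [x [y xy fxy]] : ~~ injectiveb f.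
    apply/injectiveP => /leq_card; rewrite !card_ord ltnn//.
  have gxy : g x = g y by move/(congr1 val): fxy.
  have gB n : (g n)%:R * c <= u n + B < (g n)%:R * c + c.
    have /andP[h1 h2] := uB n.
    have q0 : 0 <= (u n + B) / c by apply: divr_ge0; lra.
    have /andP[] := truncn_itv q0; rewrite ler_pdivlMr// ltr_pdivrMr// => -> /=.
    by rewrite -natr1 mulrDl mul1r.
  have cl : `|u x - u y| < c.
    have /andP[+ +] := gB x; have /andP[+ +] := gB y; rewrite gxy => *.
    by rewrite ltr_norml; apply/andP; split; lra.
  have [xy'|yx'] := ltnP x y.
    by exists x, (y - x)%N; rewrite subn_gt0 xy' subnKC ?(ltnW xy')// distrC.
  exists y, (x - y)%N; rewrite subn_gt0 subnKC//; split=> //.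
  by rewrite ltn_neqAle yx' andbT eq_sym; exact: xy.
set D := u (i + p)%N - u i in close.
have D0 : D != 0 by rewrite subr_eq0 udiff.
have uD t : u (i + p + t)%N - u (i + t)%N = D.
  elim: t => [|t IH]; first by rewrite !addn0.
  rewrite !addnS; move: close; rewrite -IH ltr_norml => /andP[h1 h2].
  by case: (uS (i + p + t)%N) => -[g1 ->]; case: (uS (i + t)%N) => -[g2 ->]; lra.
have us s : u (i + s * p)%N = u i + s%:R * D.
  elim: s => [|s IH]; first by rewrite mul0n addn0 mul0r addr0.
  have := uD (s * p)%N; rewrite -addnA -mulSn => /eqP; rewrite subr_eq => /eqP ->.
  by rewrite IH -natr1; ring.
pose s := (Num.truncn ((B + B) / `|D|)).+1.
have sD : B + B < s%:R * `|D|.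
  have B0 : 0 < B by have /andP[] := uB 0%N; lra.
  have q0 : 0 <= (B + B) / `|D| by apply: divr_ge0 => //; lra.
  have /andP[_] := truncn_itv q0; by rewrite ltr_pdivrMr ?normr_gt0.
have /andP[h1 h2] := uB i; have := uB (i + s * p)%N; rewrite us => /andP[h3 h4].
by move: sD; case: (ger0P D) => _; lra.
Qed.

Lemma return_exists (R : realType) (d : nat) (alpha : 'I_d -> R) (tau : 'S_d)
    (lambda eta : R) (z : R[i]) :
  (2 <= d)%N -> admissible alpha -> 0 < lambda -> irrational lambda ->
  middle_cone alpha z ->
  exists2 n : nat, (1 <= n)%N &
    middle_cone alpha (iter n (tce alpha tau lambda eta) z).
Proof.
move=> /ltnW d0 Aal l0 lirr [j _ [z0 _]].
apply: contrapT => nret.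
set F := tce alpha tau lambda eta in nret.
have Fupper w : upper_half_plane w -> upper_half_plane (F w).
  rewrite /upper_half_plane /= translation_upper; exact: exchange_upper.
pose v n := iter n F (F z).
have v0 n : upper_half_plane (v n).
  by elim: n => [|n IH]; [exact: Fupper|rewrite /v iterS; exact: Fupper].
have vm n : ~ middle_cone alpha (v n).
  by move=> vn; apply: nret; exists n.+1 => //; rewrite iterSr.
pose c := complex.Im (v 0%N) * cos (beta alpha).
have vS n : let c := complex.Im (v n) * cos (beta alpha) in
    (c < complex.Re (v n) /\ v n.+1 = v n - 1) \/
    (complex.Re (v n) < - c /\ v n.+1 = v n + lambda%:C).
  exact: tce_outside d0 Aal (v0 n) (@vm n).
have vim n : complex.Im (v n) = complex.Im (v 0%N).
  elim: n => // n <-.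
  by case: (vS n) => -[_ ->]; case: (v n) => x y /=; rewrite ?oppr0 addr0.
have /andP[b0 b1] := beta_bounds Aal.
have cb : 0 < cos (beta alpha).
  by apply: cos_gt0_pihalf; apply/andP; split=> //; lra.
apply: (@no_avoidance R (fun n => complex.Re (v n)) lambda c) => //.
  by rewrite mulr_gt0//; exact: (v0 0%N).
move=> n; have := vS n; rewrite vim -/c.
by case=> -[h ->]; [left|right]; split=> //; case: (v n).
Qed.

Lemma return_timeP (R : realType) (d : nat) (alpha : 'I_d -> R) (tau : 'S_d)
    (lambda eta : R) (z : R[i]) :
  (2 <= d)%N -> admissible alpha -> 0 < lambda -> irrational lambda ->
  middle_cone alpha z ->
  let N := return_time alpha tau lambda eta z in
  [/\ (1 <= N)%N, middle_cone alpha (first_return alpha tau lambda eta z) &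
    forall m : nat, (1 <= m < N)%N ->
      ~ middle_cone alpha (iter m (tce alpha tau lambda eta) z)].
Proof.
move=> d2 Aal l0 lirr zm N.
have [n n0 nm] := return_exists tau eta d2 Aal l0 lirr zm.
pose Q (n : nat) :=
  (1 <= n)%N /\ middle_cone alpha (iter n (tce alpha tau lambda eta) z).
have [[N1 N2] N3] : Q N /\ forall m, Q m -> (N <= m)%N.
  have exQ : exists n, `[< Q n >] by exists n; apply/asboolP.
  have [m /asboolP Qm mmin] := ex_minnP exQ.
  apply: (@xgetPex _ 0%N [set n | Q n /\ forall m, Q m -> (n <= m)%N]).
  by exists m; split=> // k Qk; apply: mmin; apply/asboolP.
split=> // m /andP[m0 mN] mm.
by have := N3 m (conj m0 mm); rewrite leqNgt mN.
Qed.

Lemma golden_parameters (R : realType) (k : nat) (lambda eta : R) :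
  (1 <= k)%N -> lambda = 1 / (k%:R + Phi R) -> eta = 1 - k%:R * lambda ->
  [/\ 0 < lambda, irrational lambda & 0 < eta < lambda].
Proof.
move=> k1 lE eE.
have s0 : 0 <= Num.sqrt 5 :> R by [].
have s2 : Num.sqrt 5 ^+ 2 = 5 :> R by rewrite sqr_sqrtr.
have P01 : 0 < Phi R < 1 by rewrite /Phi; apply/andP; split; nra.
have /andP[P0 P1] := P01.
have k1' : (1 : R) <= k%:R by rewrite ler1n.
have kP : 0 < k%:R + Phi R by lra.
have l0 : 0 < lambda by rewrite lE divr_gt0.
have lk : lambda * (k%:R + Phi R) = 1 by rewrite lE mulrAC mul1r divff ?gt_eqF.
split=> //; last by rewrite eE; apply/andP; split; nra.
move=> [q _ ql].
have [p ps] : exists p : rat, ratr p = Num.sqrt 5 :> R.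
  exists (2 * (q^-1 - k%:R) + 1).
  rewrite rmorphD rmorphM rmorphB fmorphV !rmorph_nat rmorph1 /= ql.
  by rewrite lE invf_div divr1 /Phi; field.
have p2 : p ^+ 2 = 5.
  by apply: (fmorph_inj (@ratr R)); rewrite rmorphXn /= ps s2 rmorph_nat.
have [a [b [b0 cop]]] : exists a b : nat, (0 < b)%N /\ (a ^ 2 = 5 * b ^ 2)%N.
  exists `|numq p|%N, `|denq p|%N; split; first by rewrite absz_gt0 denq_neq0.
  have dn : (denq p)%:~R != 0 :> rat by rewrite intr_eq0 denq_neq0.
  have H : (numq p) ^+ 2 = 5 * (denq p) ^+ 2 :> int.
    apply: (@intr_inj rat); rewrite !expr2 !intrM.
    have -> : (numq p)%:~R = p * (denq p)%:~R.
      by rewrite -{2}(divq_num_den p) divfK.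
    have -> : 5%:~R = 5 :> rat by [].
    by rewrite -p2; ring.
  by have := congr1 absz H; rewrite abszX abszM abszX.
have a0 : (0 < a)%N.
  by case: (posnP a) cop => // ->; case: b b0.
have := congr1 (logn 5) cop.
rewrite lognM ?expn_gt0 ?b0// !lognX.
by move=> /(congr1 odd); rewrite oddD !oddM.
Qed.

(* Main.v *)
Require Import Defs.
From HB Require Import structures.
From mathcomp Require Import all_boot all_order all_algebra all_fingroup.
From mathcomp Require Import all_classical all_reals all_analysis.
From mathcomp Require Import complex.
From mathcomp Require Import ring lra.

Set Implicit Arguments.
Unset Strict Implicit.
Unset Printing Implicit Defensive.

Import Order.TTheory GRing.Theory Num.Theory.
Import numFieldNormedType.Exports.

Local Open Scope classical_set_scope.
Local Open Scope ring_scope.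
Local Open Scope complex_scope.

(** The middle cone is the set of points x + iy of the upper half plane with
    |x| <= y cot(beta). On the way from z back to this cone, the height y only
    changes when E turns z, inside the middle cone, into a point w. From then
    on only the real part moves: with c = Im(w) cot(beta), it starts at
    Re(w) - eta and performs +lambda to the left of the window [-c, c], -1 to
    its right, until it lands in the window. The relation [lands p q c u v]
    describes such a motion with steps +p and -q, and [first_return_lands]
    makes the translation.

    The theorem is then Rauzy induction for this motion. As long as u is to
    the left of p - c, a step -(q + kp) from the right of the window is forced
    to be followed by k steps +p, so steps (p, q + kp) and (p, q) have the same
    landing point ([lands_rauzy]); the mirror image exchanges the roles of p
    and q. Since lambda = 1 / (k + Phi) means 1 = lambda Phi + k lambda, the
    steps (lambda, 1) may be replaced by (lambda, lambda Phi), where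
    lambda Phi = eta. The relation Phi^2 + Phi = 1 allows two more
    replacements, one mirrored and one not, which lead to
    (lambda Phi^2, lambda Phi^3): the same steps multiplied by Phi^2
    ([lands_golden]). All this holds once c is small compared with lambda, that
    is, for z close to the origin.

    Hence scaling a trajectory of (lambda, eta) by Phi^2 gives a trajectory of
    (lambda Phi^2, eta Phi^2), which lands where the trajectory of (lambda, eta)
    from Phi^2 Re(w) - eta does ([lands_renormalization]). As E commutes with
    positive dilations, this is the equation R(Phi^2 z) = Phi^2 R(z). *)

(** * Landing in a window with two steps *)

(** A relation rather than an iteration up to a stopping time: regrouping steps,
    as Rauzy induction does, is then an induction on derivations, without any
    counting. *)
Inductive lands (R : realFieldType) (p q c : R) : R -> R -> Prop :=
| lands_stop u : - c <= u <= c -> lands p q c u u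
| lands_left u v : u < - c -> lands p q c (u + p) v -> lands p q c u v
| lands_right u v : c < u -> lands p q c (u - q) v -> lands p q c u v.

Lemma lands_inj (R : realFieldType) (p q c u v w : R) : 0 <= c ->
  lands p q c u v -> lands p q c u w -> v = w.
Proof.
move=> c0 uv; elim: uv w => {u v} [u uc|u v uc _ IH|u v uc _ IH] w uw.
- by case: uw uc => // {w} u' w uc' _ /andP[]; lra.
- by case: uw uc IH => {w} [u' /andP[]|u' w _ uw _|u' w uc' _ uc];
    [lra | apply | lra].
- by case: uw uc IH => {w} [u' /andP[]|u' w uc' _ uc|u' w _ uw _];
    [lra | lra | apply].
Qed.

(** The mirror image x |-> - x turns left steps into right steps. *)
Lemma lands_opp (R : realFieldType) (p q c u v : R) :
  lands p q c u v -> lands q p c (- u) (- v).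
Proof.
elim=> {u v} [u /andP[u1 u2]|u v uc _ IH|u v uc _ IH].
- by apply: lands_stop; apply/andP; split; lra.
- by apply: lands_right; [lra | rewrite -(opprD u p)].
- by apply: lands_left; [lra | rewrite addrC -(opprB u q)].
Qed.

Lemma lands_scale (R : realFieldType) (s p q c u v : R) : 0 < s ->
  lands p q c u v -> lands (s * p) (s * q) (s * c) (s * u) (s * v).
Proof.
move=> s0; elim=> {u v} [u uc|u v uc _ IH|u v uc _ IH].
- by apply: lands_stop; rewrite -mulrN !ler_pM2l.
- by apply: lands_left; rewrite -?mulrN ?ltr_pM2l// -mulrDr.
- by apply: lands_right; rewrite ?ltr_pM2l// -mulrBr.
Qed.

(** A run of left steps is forced when its last one starts to the left of the
    window, because the earlier ones start even further left. *)
Lemma lands_add_lefts (R : realFieldType) (p q c u v : R) (k : nat) :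
  0 <= p -> u - p < - c -> lands p q c u v -> lands p q c (u - p *+ k) v.
Proof.
move=> p0 uc uv; elim: k => [|k IH]; first by rewrite mulr0n subr0.
apply: lands_left; last by rewrite mulrS opprD addrA addrAC addrNK.
by rewrite mulrS; have := mulrn_wge0 k p0; lra.
Qed.

(** * Rauzy induction *)

(** Both motions stay to the left of p - c: a left step starts below - c, and a
    long right step, once completed by k left steps, amounts to - q. From such
    a point u the k left steps are forced, because the last of them starts at
    u - q - p, which is below - c. *)
Lemma lands_rauzy (R : realFieldType) (p q c u v : R) (k : nat) :
  0 <= p -> 0 <= q -> 0 <= c -> u < p - c ->
  lands p (q + p *+ k) c u v <-> lands p q c u v.
Proof.
move=> p0 q0 c0 uc; split=> uv.
  (* The points u of a trajectory with long steps may be in the middle of the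
     run of left steps after a right step: p *+ j is what remains of the run. *)
  have gen j : u + p *+ j < p - c -> lands p q c (u + p *+ j) v.
    elim: uv j => {u v uc} [u /andP[u1 u2]|u v uc _ IH|u v uc _ IH] [|j].
    + by rewrite mulr0n addr0 => _; apply: lands_stop; rewrite u1.
    + by rewrite mulrS; have := mulrn_wge0 j p0; lra.
    + rewrite mulr0n addr0 => _; apply: lands_left => //.
      by have := IH 0%N; rewrite mulr0n addr0; apply; lra.
    + by rewrite mulrS addrA; exact: IH.
    + rewrite mulr0n addr0 => up; apply: lands_right => //.
      have := IH k; rewrite opprD addrA addrNK; apply; lra.
    + by rewrite mulrS; have := mulrn_wge0 j p0; lra.
  by have := gen 0%N; rewrite mulr0n addr0; apply.
elim: uv uc => {u v} [u uc _|u v uc _ IH up|u v uc _ IH up].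
- exact: lands_stop.
- by apply: lands_left => //; apply: IH; lra.
- apply: lands_right => //; rewrite opprD addrA.
  by apply: lands_add_lefts; [|lra|apply: IH; lra].
Qed.

Lemma lands_rauzy_opp (R : realFieldType) (p q c u v : R) (k : nat) :
  0 <= p -> 0 <= q -> 0 <= c -> c - q < u ->
  lands (p + q *+ k) q c u v <-> lands p q c u v.
Proof.
move=> p0 q0 c0 uc.
have mir a b : lands a b c u v <-> lands b a c (- u) (- v).
  by split=> /lands_opp //; rewrite !opprK.
by rewrite !mir; apply: lands_rauzy => //; lra.
Qed.

(** One step of Rauzy induction on each side: with f^2 + f = 1,
    (p, p f) = (p f^2 + p f, p f) reduces to (p f^2, p f), and
    (p f^2, p f) = (p f^2, p f^3 + p f^2) reduces to (p f^2, p f^3). *)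
Lemma lands_golden (R : realFieldType) (f p c u v : R) :
  0 < f -> f ^+ 2 + f = 1 -> 0 < p -> 0 <= c ->
  c - p * f < u < p * f ^+ 2 - c ->
  lands p (p * f) c u v <->
  lands (f ^+ 2 * p) (f ^+ 2 * (p * f)) c u v.
Proof.
move=> f0 ff p0 c0 /andP[u1 u2].
have pf : 0 < p * f by rewrite mulr_gt0.
have pff : 0 < p * f ^+ 2 by rewrite mulr_gt0// exprn_gt0.
have pfff : 0 < p * f ^+ 2 * f by rewrite mulr_gt0.
have e1 : p = p * f ^+ 2 + (p * f) *+ 1 by rewrite mulr1n -mulrDr ff mulr1.
have e2 : p * f = p * f ^+ 2 * f + (p * f ^+ 2) *+ 1.
  by rewrite mulr1n -[LHS]mulr1 -ff; ring.
have -> : f ^+ 2 * p = p * f ^+ 2 by rewrite mulrC.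
have -> : f ^+ 2 * (p * f) = p * f ^+ 2 * f by ring.
rewrite {1}e1 lands_rauzy_opp ?(ltW pf) ?(ltW pff)//.
by rewrite {1}e2; apply: lands_rauzy => //; exact: ltW.
Qed.

(** The scaled trajectory starts at f^2 x - p f^3, which is not where the
    trajectory of f^2 x starts; but p f^3 = p f - p + p f, so the latter gets
    there after one left step and one right step. The bound on c makes both
    steps start outside of the window, and puts the start of the scaled
    trajectory in the range where [lands_golden] applies. *)
Lemma lands_renormalization (R : realFieldType) (f p c x v : R) :
  0 < f -> f ^+ 2 + f = 1 -> 0 < p -> - c <= x <= c -> 2 * c < p * f ^+ 2 ->
  lands p (p * f) c (x - p * f) v ->
  lands p (p * f) (f ^+ 2 * c) (f ^+ 2 * x - p * f) (f ^+ 2 * v).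
Proof.
move=> f0 ff p0 /andP[x1 x2] cp uv.
have c0 : 0 <= c by lra.
have f1 : f < 1 by nra.
have ff0 : 0 < f ^+ 2 by rewrite exprn_gt0.
have pf : 0 < p * f by rewrite mulr_gt0.
have pff : 0 < p * f ^+ 2 by rewrite mulr_gt0.
have pE : p = p * f + p * f ^+ 2 by rewrite -mulrDr addrC ff mulr1.
have pfE : p * f = p * f ^+ 2 + f ^+ 2 * (p * f).
  by rewrite -[LHS]mulr1 -ff; ring.
have fc : f ^+ 2 * c <= c by rewrite ler_piMl// ; lra.
have fx1 : - (f ^+ 2 * c) <= f ^+ 2 * x by rewrite -mulrN ler_pM2l.
have fx2 : f ^+ 2 * x <= f ^+ 2 * c by rewrite ler_pM2l.
have fc0 : 0 <= f ^+ 2 * c by rewrite mulr_ge0// ltW.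
have pfff : 0 < f ^+ 2 * (p * f) by rewrite mulr_gt0.
apply: lands_left; first by lra.
apply: lands_right; first by lra.
have -> : f ^+ 2 * x - p * f + p - p * f = f ^+ 2 * (x - p * f).
  by rewrite mulrBr; lra.
apply/(lands_golden _ f0 ff p0) => //; last exact: lands_scale.
by rewrite mulrBr; apply/andP; split; lra.
Qed.

(** * The middle cone as a window for the real part *)

Definition cotangent (R : realType) (t : R) : R := cos t / sin t.

Lemma polar_upper (R : realType) (z : R[i]) : upper_half_plane z ->
  exists2 r : R, 0 < r & z = r%:C * cis (arg z).
Proof.
move=> z0; have zn0 : z != 0.
  move: z0; rewrite /upper_half_plane/=.
  by apply: contraTneq => ->; rewrite ltxx.
have [_ zE] := arg_polar zn0.
exists (Num.sqrt (complex.Re z ^+ 2 + complex.Im z ^+ 2)) => //.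
by rewrite sqrtr_gt0 ltr_wpDl ?sqr_ge0 ?exprn_gt0.
Qed.

(** After division by r, and multiplication by sin b > 0, the two inequalities
    on the right say that sin (t + b) and sin (t - b) are nonnegative. *)
Lemma polar_window (R : realType) (b r t : R) :
  0 < b < pi / 2 -> 0 < r -> 0 < t < pi ->
  (b <= t <= pi - b) =
  (- (r * sin t * cotangent b) <= r * cos t <= r * sin t * cotangent b).
Proof.
move=> /andP[b0 b1] r0 /andP[t0 t1].
have sb : 0 < sin b by apply: sin_gt0_pi; apply/andP; split; lra.
have cotE : r * sin t * cotangent b = r * (sin t * cos b) / sin b.
  by rewrite /cotangent !mulrA.
rewrite cotE -mulNr ler_pdivlMr// ler_pdivrMr// -mulrN -!mulrA !ler_pM2l//.
rewrite [X in _ = X && _]lerNl -[X in _ = X && _]subr_ge0.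
rewrite -[X in _ = _ && X]subr_ge0.
have -> : sin t * cos b - - (cos t * sin b) = sin (t + b) by rewrite sinD; ring.
have -> : sin t * cos b - cos t * sin b = sin (t - b).
  by rewrite sinD cosN sinN; ring.
rewrite andbC; congr andb.
- have [tb|tb] := leP t (pi - b).
    by rewrite sin_ge0_pi//; apply/andP; split; lra.
  apply/esym/negbTE; rewrite -ltNge.
  rewrite -[t + b](subrK pi) sinDpi oppr_lt0.
  by apply: sin_gt0_pi; apply/andP; split; lra.
- have [tb|tb] := leP b t.
    by rewrite sin_ge0_pi//; apply/andP; split; lra.
  apply/esym/negbTE; rewrite -ltNge -opprB sinN oppr_lt0.
  by apply: sin_gt0_pi; apply/andP; split; lra.
Qed.

Lemma middle_cone_arg (R : realType) (d : nat) (alpha : 'I_d -> R) (z : R[i]) :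
  admissible alpha -> middle_cone alpha z ->
  beta alpha <= arg z <= pi - beta alpha.
Proof.
move=> [a0 _] [[|j] //= jd [_ Wz]].
have /andP[h1 h2] := W_bounds (j := Ordinal jd) Wz.
have cut_le (m n : nat) : (m <= n)%N -> Defs.cut alpha m <= Defs.cut alpha n.
  move=> mn; rewrite /Defs.cut lerD2l big_mkcond [leRHS]big_mkcond /=.
  apply: ler_sum => i _; case: ifP => im; last by case: ifP => // _; exact: ltW.
  by rewrite (leq_trans im mn).
apply/andP; split.
  by rewrite -(cut0 alpha) (le_trans _ h1)// cut_le.
by rewrite -(cut_last alpha) (le_trans h2)// cut_le.
Qed.

Lemma middle_coneP (R : realType) (d : nat) (alpha : 'I_d -> R) (z : R[i]) :
  (0 < d)%N -> admissible alpha -> upper_half_plane z ->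
  let c := complex.Im z * cotangent (beta alpha) in
  middle_cone alpha z <-> - c <= complex.Re z <= c.
Proof.
move=> d0 Aal z0 /=.
have [r r0 zE] := polar_upper z0.
have := polar_window (beta_bounds Aal) r0 (arg_upper z0).
have -> : r * sin (arg z) = complex.Im z by rewrite {2}zE /= mul0r addr0.
have -> : r * cos (arg z) = complex.Re z by rewrite {2}zE /= mul0r subr0.
by move=> <-; split; [exact: middle_cone_arg | exact: middle_coneE].
Qed.

Lemma middle_cone_upper (R : realType) (d : nat) (alpha : 'I_d -> R)
    (z : R[i]) :
  middle_cone alpha z -> upper_half_plane z.
Proof. by case=> j _ []. Qed.

(** * The exchange of cones *)

(** The exchange moves the j-th subcone to the angles between beta + S2 and
    beta + S2 + alpha_j, where S2 is the total angle of the subcones that the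
    permutation puts before it. *)
Lemma exchange_angle (R : realType) (d : nat) (alpha : 'I_d -> R) (tau : 'S_d)
    (j : 'I_d) (t : R) : admissible alpha -> W alpha j.+1 t ->
  beta alpha <= t + theta alpha tau j <= pi - beta alpha.
Proof.
move=> [apos _] /W_bounds /andP[t1 t2].
set S1 := \sum_(i < d | (i < j)%N) alpha i.
set S2 := \sum_(i < d | (tau i < tau j)%N) alpha i.
have t1' : beta alpha + S1 <= t by [].
have t2' : t <= beta alpha + S1 + alpha j.
  apply: le_trans t2 _; rewrite /Defs.cut -(addrA (beta alpha)) lerD2l.
  rewrite (bigD1 j) //= addrC lerD2r le_eqVlt; apply/orP; left; apply/eqP.
  by apply: eq_bigl => i; rewrite ltnS ltn_neqAle andbC -val_eqE.
have S20 : 0 <= S2 by apply: sumr_ge0 => i _; exact: ltW.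
have S2a : S2 + alpha j <= \sum_i alpha i.
  rewrite [leRHS](bigD1 j) //= (addrC S2) lerD2l /S2.
  rewrite big_mkcond [leRHS]big_mkcond /=.
  apply: ler_sum => i _; case: ifP => ij; last by case: ifP => // _; exact: ltW.
  by rewrite ifT//; apply: contraTneq ij => ->; rewrite ltnn.
have thE : theta alpha tau j = S2 - S1 by [].
by rewrite thE; apply/andP; split; first lra; rewrite /beta in t2' *; lra.
Qed.

Lemma cisD (R : realType) (s t : R) : cis (s + t) = cis s * cis t.
Proof.
by rewrite /cis sinD cosD; apply/eqP; rewrite eq_complex /= eqxx addrC eqxx.
Qed.

Lemma exchange_middle (R : realType) (d : nat) (alpha : 'I_d -> R) (tau : 'S_d)
    (z : R[i]) : (0 < d)%N -> admissible alpha -> middle_cone alpha z ->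
  middle_cone alpha (exchange alpha tau z).
Proof.
move=> d0 Aal zm; have Ez0 := exchange_upper tau Aal (middle_cone_upper zm).
move: Ez0; rewrite /exchange; case: pickP => [j|//].
rewrite inE => -[z0 Wz] Ez0; apply/(middle_coneP d0 Aal Ez0).
have [r r0 zE] := polar_upper z0.
have bt := exchange_angle tau Aal Wz; have b_pi := beta_bounds Aal.
have t_pi : 0 < arg z + theta alpha tau j < pi.
  by case/andP: bt b_pi => ? ? /andP[? ?]; apply/andP; split; lra.
move: bt; rewrite (polar_window b_pi r0 t_pi).
have -> : z * cis (theta alpha tau j) = r%:C * cis (arg z + theta alpha tau j).
  by rewrite {1}zE -mulrA cisD.
by rewrite /= !mul0r subr0 addr0.
Qed.

Lemma arg_scale (R : realType) (s : R) (z : R[i]) : 0 < s ->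
  arg (s%:C * z) = arg z.
Proof.
case: z => x y s0; rewrite /arg /= !mul0r subr0 addr0 pmulr_rge0//.
have -> : (s * x) ^+ 2 + (s * y) ^+ 2 = s ^+ 2 * (x ^+ 2 + y ^+ 2) by ring.
rewrite sqrtrM ?sqr_ge0// sqrtr_sqr gtr0_norm//.
by rewrite -mulf_div divff ?gt_eqF// mul1r.
Qed.

Lemma cone_scale (R : realType) (d : nat) (alpha : 'I_d -> R) (j : nat)
    (s : R) (z : R[i]) :
  0 < s -> cone alpha j (s%:C * z) <-> cone alpha j z.
Proof.
move=> s0; rewrite /cone /upper_half_plane /= arg_scale//.
by case: z => x y /=; rewrite mul0r addr0 pmulr_rgt0.
Qed.

Lemma middle_cone_scale (R : realType) (d : nat) (alpha : 'I_d -> R)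
    (s : R) (z : R[i]) :
  0 < s -> middle_cone alpha z -> middle_cone alpha (s%:C * z).
Proof. by move=> s0 [j jd /(cone_scale _ _ _ s0) zj]; exists j. Qed.

Lemma exchange_scale (R : realType) (d : nat) (alpha : 'I_d -> R) (tau : 'S_d)
    (s : R) (z : R[i]) : 0 < s ->
  exchange alpha tau (s%:C * z) = s%:C * exchange alpha tau z.
Proof.
move=> s0; rewrite /exchange.
have e : (fun j : 'I_d => s%:C * z \in cone alpha j.+1)
    =1 (fun j => z \in cone alpha j.+1).
  by move=> j; apply/idP/idP; rewrite !inE => /(cone_scale _ _ _ s0).
by rewrite (eq_pick e); case: pickP => // j _; rewrite mulrA.
Qed.

Lemma exchange_norm (R : realType) (d : nat) (alpha : 'I_d -> R) (tau : 'S_d)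
    (z : R[i]) : `|exchange alpha tau z| = `|z|.
Proof.
rewrite /exchange; case: pickP => // j _; rewrite normrM.
by rewrite (normc_def (cis _)) /= cos2Dsin2 sqrtr1 mulr1.
Qed.

(** * First returns as landings *)

Lemma cotangent_gt0 (R : realType) (t : R) : 0 < t < pi / 2 -> 0 < cotangent t.
Proof.
move=> /andP[t0 t1]; rewrite divr_gt0//; last first.
  by apply: sin_gt0_pi; apply/andP; split; lra.
by apply: cos_gt0_pihalf; apply/andP; split; lra.
Qed.

(** Sharp thresholds for [tce_outside], whose bound Im(w) cos(beta) lies inside
    the window: it fixes on which side of the window Re(w) is, and being outside
    of the middle cone does the rest. *)
Lemma tce_outside_step (R : realType) (d : nat) (alpha : 'I_d -> R) (tau : 'S_d)
    (lambda eta : R) (w : R[i]) :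
  (0 < d)%N -> admissible alpha -> upper_half_plane w ->
  ~ middle_cone alpha w ->
  let c := complex.Im w * cotangent (beta alpha) in
  (c < complex.Re w /\ tce alpha tau lambda eta w = w - 1) \/
  (complex.Re w < - c /\ tce alpha tau lambda eta w = w + lambda%:C).
Proof.
move=> d0 Aal w0 wm c.
have /andP[b0 b1] := beta_bounds Aal.
have c0 : 0 < c by rewrite mulr_gt0// cotangent_gt0// b0.
have y0 : 0 < complex.Im w * cos (beta alpha).
  by rewrite mulr_gt0//; apply: cos_gt0_pihalf; apply/andP; split; lra.
have out : ~~ (- c <= complex.Re w <= c).
  by apply/negP => /(middle_coneP d0 Aal w0).
have [[wc wE]|[wc wE]] := tce_outside tau lambda eta d0 Aal w0 wm; [left|right];
  by split=> //; rewrite ltNge; apply: contra out => ?; apply/andP; split; lra.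
Qed.

Lemma lands_iter (R : realType) (d : nat) (alpha : 'I_d -> R) (tau : 'S_d)
    (lambda eta : R) (n : nat) (w : R[i]) :
  (0 < d)%N -> admissible alpha -> upper_half_plane w ->
  let F := tce alpha tau lambda eta in
  middle_cone alpha (iter n F w) ->
  (forall m, (m < n)%N -> ~ middle_cone alpha (iter m F w)) ->
  lands lambda 1 (complex.Im w * cotangent (beta alpha))
    (complex.Re w) (complex.Re (iter n F w)) /\
  complex.Im (iter n F w) = complex.Im w.
Proof.
move=> d0 Aal + F; elim: n w => [|n IH] w w0 wn wlt.
  by split=> //; apply: lands_stop; apply/(middle_coneP d0 Aal w0).
have := tce_outside_step tau lambda eta d0 Aal w0 (wlt 0%N isT).
rewrite -/F /= => Fw.
have Fim : complex.Im (F w) = complex.Im w.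
  by case: Fw => -[_ ->]; case: (w) => x y /=; rewrite ?oppr0 addr0.
rewrite -iterS iterSr in wn *.
have Fw0 : upper_half_plane (F w) by rewrite /upper_half_plane /= Fim.
have Flt m : (m < n)%N -> ~ middle_cone alpha (iter m F (F w)).
  by move=> mn; rewrite -iterSr; apply: wlt.
have [+ ->] := IH _ Fw0 wn Flt; rewrite Fim => Fl; split=> //.
case: Fw => -[wc wE]; [apply: lands_right => //|apply: lands_left => //];
  by move: Fl; rewrite {1}wE; case: (w).
Qed.

(** The exchange leaves w in the middle cone, so the first translation is by
    - eta; every later point before the return is outside of the middle cone,
    where the exchange is the identity. *)
Lemma first_return_lands (R : realType) (d : nat) (alpha : 'I_d -> R)
    (tau : 'S_d) (lambda eta : R) (z : R[i]) :
  (2 <= d)%N -> admissible alpha -> 0 < lambda -> irrational lambda ->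
  middle_cone alpha z ->
  let w := exchange alpha tau z in
  let z' := first_return alpha tau lambda eta z in
  lands lambda 1 (complex.Im w * cotangent (beta alpha))
    (complex.Re w - eta) (complex.Re z') /\
  complex.Im z' = complex.Im w.
Proof.
move=> d2 Aal l0 lirr zm w z'; have d0 := ltnW d2.
have wm : middle_cone alpha w by exact: exchange_middle.
have Fz : tce alpha tau lambda eta z = w - eta%:C.
  rewrite /tce /translation -/w memNset ?mem_set// => -[_ /=].
  rewrite in_itv /= => /andP[_]; rewrite ltNge.
  by have /andP[->] := middle_cone_arg Aal wm.
have [N1 zN zlt] := return_timeP tau eta d2 Aal l0 lirr zm.
rewrite /z' /first_return; move: N1 zN zlt; rewrite /first_return.
case: return_time => // n _; rewrite !iterSr Fz => wn zlt.
have Im_w : complex.Im (w - eta%:C) = complex.Im w.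
  by case: (w) => x y /=; rewrite oppr0 addr0.
have -> : complex.Re w - eta = complex.Re (w - eta%:C) by case: (w).
rewrite -Im_w; apply: lands_iter => //.
  by rewrite /upper_half_plane /= Im_w; exact: middle_cone_upper wm.
by move=> m mn; rewrite -Fz -iterSr; apply: zlt.
Qed.

(** * Self-similarity of the first return map *)

Lemma Phi_eq (R : realType) : 0 < Phi R /\ Phi R ^+ 2 + Phi R = 1.
Proof.
have s2 : Num.sqrt 5 ^+ 2 = 5 :> R by rewrite sqr_sqrtr.
have s1 : 1 < Num.sqrt 5 :> R.
  by rewrite -[ltLHS]sqrtr1 ltr_sqrt ?ltr1n.
split; first by rewrite divr_gt0// subr_gt0.
by rewrite /Phi; field: s2.
Qed.

Theorem theoremA (R : realType) (d : nat) (hd : (2 <= d)%N) (tau : 'S_d)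
    (alpha : 'I_d -> R) (halpha : admissible alpha)
    (k : nat) (hk : (1 <= k)%N) (lambda eta : R)
    (hlambda : lambda = 1 / (k%:R + Phi R)) (heta : eta = 1 - k%:R * lambda) :
  exists U : set R[i]^o,
    [/\ open U, U 0 &
      forall z : R[i], (U `&` middle_cone alpha) z ->
        first_return alpha tau lambda eta ((Phi R ^+ 2)%:C * z)
        = (Phi R ^+ 2)%:C * first_return alpha tau lambda eta z].
Proof.
have [f0 ff] := Phi_eq R; set f := Phi R in f0 ff hlambda *.
have [l0 lirr /andP[e0 _]] := golden_parameters hk hlambda heta.
have etaE : eta = lambda * f.
  have kf : k%:R + f != 0 by rewrite gt_eqF// ltr_wpDl.
  by rewrite heta hlambda; field.
have lE : 1 = lambda * f + lambda *+ k.
  by rewrite -etaE heta -mulr_natl; ring.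
have f20 : 0 < f ^+ 2 by rewrite exprn_gt0.
have lf0 : 0 < lambda * f by rewrite mulr_gt0.
set cot := cotangent (beta alpha).
have cot0 : 0 < cot by apply/cotangent_gt0/beta_bounds.
(* E preserves the modulus, so the half-width Im(w) cot(beta) of the window is
   at most |z| cot(beta), which for |z| < eps is below lambda Phi^2 / 2. *)
pose eps := lambda * f ^+ 2 / (2 * cot).
have eps0 : 0 < eps by apply: divr_gt0; apply: mulr_gt0.
exists (ball (0 : R[i]^o) eps%:C); split.
- exact: ball_open.
- by apply: ballxx; rewrite ltcR.
move=> z [zU zm].
have [] := first_return_lands tau eta hd halpha l0 lirr zm.
have szm := middle_cone_scale f20 zm.
have [] := first_return_lands tau eta hd halpha l0 lirr szm.
rewrite exchange_scale//.
set w := exchange alpha tau z.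
set z1 := first_return _ _ _ _ _; set z2 := first_return _ _ _ _ _.
have wm : middle_cone alpha w by apply: exchange_middle => //; exact: ltnW.
have w0 := middle_cone_upper wm.
have := wm => /(middle_coneP (ltnW hd) halpha w0); rewrite -/cot.
have wc : 2 * (complex.Im w * cot) < lambda * f ^+ 2.
  have weps : complex.Im w < eps.
    move: zU; rewrite -ball_normE /= sub0r normrN -(exchange_norm alpha tau).
    rewrite -/w normc_def ltcR; apply: le_lt_trans.
    rewrite -[leLHS]gtr0_norm// -sqrtr_sqr ler_wsqrtr// lerDr sqr_ge0//.
  by rewrite mulrCA -ltr_pdivlMr// mulr_gt0.
have -> : complex.Im ((f ^+ 2)%:C * w) = f ^+ 2 * complex.Im w.
  by case: (w) => x y /=; rewrite mul0r addr0.
have -> : complex.Re ((f ^+ 2)%:C * w) = f ^+ 2 * complex.Re w.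
  by case: (w) => x y /=; rewrite mul0r subr0.
rewrite -(mulrA (f ^+ 2)); set c := _ * cot in wc *.
have c0 : 0 < c by rewrite mulr_gt0.
move=> wx z1_lands z1_im z2_lands z2_im.
have f1 : f ^+ 2 < 1 by lra.
have fc : f ^+ 2 * c <= c by rewrite ler_piMl// ltW.
have lf : lambda * f ^+ 2 < lambda by rewrite gtr_pMr.
have regroup c' u v : 0 <= c' -> u < lambda - c' ->
    lands lambda 1 c' u v <-> lands lambda (lambda * f) c' u v.
  by move=> *; rewrite {1}lE; apply: lands_rauzy => //; exact: ltW.
have /andP[wx1 wx2] := wx.
have z2_regrouped :
    lands lambda (lambda * f) c (complex.Re w - lambda * f) (complex.Re z2).
  by apply/regroup; rewrite -?etaE// ?ltW//; lra.
have z2_scaled := lands_renormalization f0 ff l0 wx wc z2_regrouped.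
have fx : f ^+ 2 * complex.Re w <= f ^+ 2 * c by rewrite ler_pM2l.
have z1_re : complex.Re z1 = f ^+ 2 * complex.Re z2.
  have fc0 : 0 <= f ^+ 2 * c by rewrite mulr_ge0// ltW.
  apply: (lands_inj fc0 z1_lands); apply/regroup => //; rewrite etaE//; lra.
apply/eqP; rewrite eq_complex z1_re z1_im -z2_im.
by case: (z2) => x y /=; rewrite !mul0r subr0 addr0 !eqxx.
Qed.
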